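(* Let $\{G_n\}_{n=1}^{\infty}$ be a totally greedy type-1-sequence and $\{J_n\}_{n=1}^{\infty}$ a totally greedy type-2-sequence. Then the odd subsequences $\{G_{2k-1}\}_{k=1}^{\infty}$ and $\{J_{2k-1}\}_{k=1}^{\infty}$ are also totally greedy.
   Context: A type-1-sequence is a sequence $\{G_n\}_{n=1}^\infty$ defined by $G_1 = 1$, $G_2 = a$, $G_n = pG_{n-1} + qG_{n-2}$ for $n>2$, where $a,p,q$ are positive integers with $a>1$ and $q \le p$. A type-2-sequence is a sequence $\{J_n\}_{n=1}^\infty$ defined by $J_1 = 1$, $J_2 = a$, $J_n = pJ_{n-1} - qJ_{n-2}$ for $n>2$, where $a,p,q$ are integers with $a>1$, $p>0$ and $1 \le q < p-1$. (The parameters of the two sequences are unrelated.) Let $S = \{s_1 = 1, s_2, \ldots, s_t\}$ be a set of integers (coin denominations) listed with $1 = s_1 < s_2 < \cdots < s_t$. For an integer $k \ge 0$, a payment vector for $k$ is a vector $(a_1, \ldots, a_t)$ of nonnegative integers with $\sum_{i=1}^t a_i s_i = k$; it is optimal if $\sum_{i=1}^t a_i$ is minimal among all payment vectors for $k$. The greedy payment vector for $k$ is obtained by running, for $i = t, t-1, \ldots, 1$: $a_i := \lfloor k/s_i \rfloor$, then replace $k$ by $k \bmod s_i$. The set $S$ is called greedy if for every integer $k \ge 0$ the greedy payment vector for $k$ is optimal. An integer sequence $\{s_n\}_{n=1}^\infty$ with $s_1 = 1$ and $s_i < s_{i+1}$ for all $i$ is called totally greedy if every prefix subset $\{1, s_2,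 \ldots, s_k\}$ is greedy. *)

(* Defs.v *)
(* MathComp. *)
From HB Require Import structures.
From mathcomp Require Import all_boot all_order all_algebra.

Set Implicit Arguments.
Unset Strict Implicit.
Unset Printing Implicit Defensive.

Import Order.TTheory GRing.Theory Num.Theory.
Local Open Scope ring_scope.

(* A set of denominations 1 = s_1 < ... < s_t is the list S of its elements in
   increasing order, so that s_i is S`_i.-1; a vector (a_1, ..., a_t) is a list
   in the same order.  That S is increasing and starts at 1 is required in
   [totally_greedy], not here. *)
Definition payment_vector (S : seq int) (k : int) (v : seq int) : Prop :=
  [/\ size v = size S,
      (forall i : nat, (i < size S)%N -> 0 <= v`_i)
    & \sum_(i < size S) v`_i * S`_i = k].

Definition optimal_payment (S : seq int) (k : int) (v : seq int) : Prop :=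
  payment_vector S k v /\
  forall w : seq int, payment_vector S k w ->
    \sum_(i < size S) v`_i <= \sum_(i < size S) w`_i.

(* The denominations and the resulting coefficients are here in decreasing
   order: a_t is computed first. *)
Fixpoint greedy_loop (D : seq int) (k : int) : seq int :=
  if D is s :: D' then (k %/ s)%Z :: greedy_loop D' (k %% s)%Z else [::].

Definition greedy_payment (S : seq int) (k : int) : seq int :=
  rev (greedy_loop (rev S) k).

Definition greedy_set (S : seq int) : Prop :=
  forall k : int, 0 <= k -> optimal_payment S k (greedy_payment S k).

(* Sequences (s_n)_{n >= 1} are functions on nat whose value at 0 is
   irrelevant. *)
Definition prefix_set (s : nat -> int) (k : nat) : seq int :=
  [seq s i | i <- iota 1 k].

Definition totally_greedy (s : nat -> int) : Prop :=
  [/\ s 1%N = 1,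
      (forall i : nat, (1 <= i)%N -> s i < s i.+1)
    & forall k : nat, (1 <= k)%N -> greedy_set (prefix_set s k)].

Definition type1_sequence (G : nat -> int) : Prop :=
  exists a p q : int,
    [/\ 1 < a, 0 < p, 0 < q & q <= p] /\
    [/\ G 1%N = 1, G 2%N = a
      & forall n : nat, (2 < n)%N -> G n = p * G (n - 1)%N + q * G (n - 2)%N].

Definition type2_sequence (J : nat -> int) : Prop :=
  exists a p q : int,
    [/\ 1 < a, 0 < p, 1 <= q & q < p - 1] /\
    [/\ J 1%N = 1, J 2%N = a
      & forall n : nat, (2 < n)%N -> J n = p * J (n - 1)%N - q * J (n - 2)%N].

Definition odd_subsequence (s : nat -> int) : nat -> int :=
  fun k : nat => s (2 * k - 1)%N.

(* Main.v *)
(* In both cases the odd subsequence satisfies a type-2 recurrence: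
   [G_(n+2) = (p^2 + 2q) G_n - q^2 G_(n-2)] and
   [J_(n+2) = (p^2 - 2q) J_n - q^2 J_(n-2)].  Every type-2 sequence is totally
   greedy, by induction on the prefix: if the greedy cost c of the prefix ending
   in s_k is subadditive, then from [s_(k+1) = p s_k - q s_(k-1)] we get
   [c y + p = c (y + p s_k) = c (y + s_(k+1) + q s_(k-1)) <= c (y + s_(k+1)) + q],
   so that trading coins of total value s_(k+1) for the new coin never increases
   the cost, and the greedy cost stays subadditive once s_(k+1) is added. *)
Require Import Defs.
From mathcomp Require Import all_boot all_order all_algebra.
From mathcomp Require Import zify ring.

Set Implicit Arguments.
Unset Strict Implicit.
Unset Printing Implicit Defensive.

Import Order.TTheory GRing.Theory Num.Theory.
Local Open Scope ring_scope.

(** Number of coins in the greedy payment, as a recursion on the prefix length that avoids list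
    reversals. *)
Fixpoint greedy_cost (s : nat -> int) (k : nat) (x : int) : int :=
  if k is j.+1 then (x %/ s k)%Z + greedy_cost s j (x %% s k)%Z else 0.

Lemma prefix_setS (s : nat -> int) (k : nat) :
  prefix_set s k.+1 = rcons (prefix_set s k) (s k.+1).
Proof. by rewrite /prefix_set -(addn1 k) iotaD map_cat cats1 add1n addn1. Qed.

Lemma size_prefix_set (s : nat -> int) (k : nat) : size (prefix_set s k) = k.
Proof. by rewrite size_map size_iota. Qed.

Lemma nth_prefix_set (s : nat -> int) (k i : nat) :
  (i < k)%N -> (prefix_set s k)`_i = s i.+1.
Proof. by move=> ik; rewrite (nth_map 0%N) ?size_iota // nth_iota. Qed.

Lemma greedy_paymentS (s : nat -> int) (k : nat) (x : int) :
  greedy_payment (prefix_set s k.+1) x =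
  rcons (greedy_payment (prefix_set s k) (x %% s k.+1)%Z) (x %/ s k.+1)%Z.
Proof. by rewrite /greedy_payment prefix_setS rev_rcons /= rev_cons. Qed.

Lemma size_greedy_payment (s : nat -> int) (k : nat) (x : int) :
  size (greedy_payment (prefix_set s k) x) = k.
Proof.
by elim: k x => [//|k IHk] x; rewrite greedy_paymentS size_rcons IHk.
Qed.

Lemma nth_greedy_payment_last (s : nat -> int) (k : nat) (x : int) :
  (greedy_payment (prefix_set s k.+1) x)`_k = (x %/ s k.+1)%Z.
Proof.
by rewrite greedy_paymentS nth_rcons size_greedy_payment ltnn eqxx.
Qed.

Lemma nth_greedy_payment (s : nat -> int) (k i : nat) (x : int) : (i < k)%N ->
  (greedy_payment (prefix_set s k.+1) x)`_i =
  (greedy_payment (prefix_set s k) (x %% s k.+1)%Z)`_i.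
Proof.
by move=> ik; rewrite greedy_paymentS nth_rcons size_greedy_payment ik.
Qed.

Lemma sum_greedy_payment (s : nat -> int) (k : nat) (x : int) :
  \sum_(i < k) (greedy_payment (prefix_set s k) x)`_i = greedy_cost s k x.
Proof.
elim: k x => [|k IHk] x; first by rewrite big_ord0.
rewrite big_ord_recr /= nth_greedy_payment_last addrC -IHk; congr (_ + _).
by apply: eq_bigr => i _; rewrite nth_greedy_payment.
Qed.

Section Greedy.

Variable s : nat -> int.
Hypothesis s1 : s 1%N = 1.
Hypothesis s_incr : forall i, (1 <= i)%N -> s i < s i.+1.

Lemma denomination_gt0 i : 0 < s i.+1.
Proof.
elim: i => [|i IHi]; first by rewrite s1.
exact: lt_trans IHi (s_incr _).
Qed.

Lemma greedy_payment_ge0 k x i : 0 <= x -> (i < k)%N ->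
  0 <= (greedy_payment (prefix_set s k) x)`_i.
Proof.
have spos := denomination_gt0.
elim: k x => [//|k IHk] x x0; rewrite ltnS leq_eqVlt => /orP[/eqP->|ik].
  by rewrite nth_greedy_payment_last divz_ge0.
by rewrite nth_greedy_payment // IHk // modz_ge0 // gt_eqF.
Qed.

(** The induction starts at one denomination, where the coin 1 absorbs whatever remainder is
    left. *)
Lemma greedy_payment_value k x : (1 <= k)%N ->
  \sum_(i < k) (greedy_payment (prefix_set s k) x)`_i * s i.+1 = x.
Proof.
elim: k x => [//|[|k] IHk] x _.
  by rewrite big_ord1 nth_greedy_payment_last s1 divz1 mulr1.
rewrite big_ord_recr /= nth_greedy_payment_last.
under eq_bigr => i _ do rewrite nth_greedy_payment //.
by rewrite IHk // addrC -divz_eq.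
Qed.

Lemma greedy_cost0 k : greedy_cost s k 0 = 0.
Proof. by elim: k => //= k IHk; rewrite div0z mod0z IHk. Qed.

Lemma greedy_cost1 x : greedy_cost s 1 x = x.
Proof. by rewrite /= s1 divz1 addr0. Qed.

Lemma greedy_costD_mul k c x :
  greedy_cost s k.+1 (c * s k.+1 + x) = c + greedy_cost s k.+1 x.
Proof.
have s0 : s k.+1 != 0 by rewrite gt_eqF // denomination_gt0.
by rewrite /= divzMDl // modzMDl addrA.
Qed.

Lemma greedy_costS_small k x : 0 <= x < s k.+1 ->
  greedy_cost s k.+1 x = greedy_cost s k x.
Proof.
by move=> xs; rewrite /= modz_small // divz_small ?add0r //
  gtz0_abs ?denomination_gt0.
Qed.

(** The form of greedy optimality suited to induction: each denomination costs 1, so subadditivity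
    bounds the greedy cost by the size of any payment. *)
Definition subadditive_cost k := forall x y, 0 <= x -> 0 <= y ->
  greedy_cost s k (x + y) <= greedy_cost s k x + greedy_cost s k y.

(** Here [s k.+1] is the first denomination outside the prefix. *)
Definition exchange_cost k := forall y, 0 <= y ->
  1 + greedy_cost s k y <= greedy_cost s k (y + s k.+1).

Lemma exchange_cost_mul k (c : nat) y : exchange_cost k -> 0 <= y ->
  c%:Z + greedy_cost s k y <= greedy_cost s k (c%:Z * s k.+1 + y).
Proof.
move=> exk y0; elim: c => [|c IHc]; first by rewrite mul0r !add0r.
have sp := denomination_gt0 k.
have -> : c.+1%:Z * s k.+1 + y = (c%:Z * s k.+1 + y) + s k.+1 by lia.
apply: le_trans (exk _ _); last by rewrite addr_ge0 // mulr_ge0 // ltW.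
by rewrite -addn1 PoszD; lia.
Qed.

(** Divide [x] by [s k.+1] and exchange once for each unit of the quotient. *)
Lemma greedy_costS_le k x : exchange_cost k -> 0 <= x ->
  greedy_cost s k.+1 x <= greedy_cost s k x.
Proof.
move=> exk x0; have sp := denomination_gt0 k.
rewrite [in leRHS](divz_eq x (s k.+1)) /=.
have : 0 <= (x %/ s k.+1)%Z by rewrite divz_ge0.
case: (x %/ s k.+1)%Z => // c _.
by apply: exchange_cost_mul; rewrite ?modz_ge0 ?gt_eqF.
Qed.

(** Quotients by [s k.+1] simply add up. The two remainders are compared in the smaller prefix;
    their sum may reach [s k.+1], whence the use of [greedy_costS_le]. *)
Lemma subadditive_costS k :
  exchange_cost k -> subadditive_cost k -> subadditive_cost k.+1.
Proof.
move=> exk subk x y x0 y0; have sp := denomination_gt0 k.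
have s0 : s k.+1 != 0 by rewrite gt_eqF.
have mge z : 0 <= (z %% s k.+1)%Z by rewrite modz_ge0.
have -> : x + y = ((x %/ s k.+1)%Z + (y %/ s k.+1)%Z) * s k.+1
                  + ((x %% s k.+1)%Z + (y %% s k.+1)%Z).
  by rewrite {1}(divz_eq x (s k.+1)) {1}(divz_eq y (s k.+1)); ring.
rewrite greedy_costD_mul.
have := greedy_costS_le exk (addr_ge0 (mge x) (mge y)).
have := subk _ _ (mge x) (mge y).
rewrite [greedy_cost s k.+1 x]/= [greedy_cost s k.+1 y]/= => le1 le2.
by rewrite [leRHS]addrACA lerD2l; apply: le_trans le2 le1.
Qed.

Lemma denomination_cost k i : (i < k)%N -> greedy_cost s k (s i.+1) = 1.
Proof.
have lt_s j : (i <= j)%N -> s i.+1 < s j.+2.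
  move=> /subnK <-; elim: (j - i)%N => [|n IHn]; first exact: s_incr.
  exact: lt_trans IHn (s_incr _).
elim: k => [//|k IHk]; rewrite ltnS leq_eqVlt => /orP[/eqP->|ik].
  have /= := greedy_costD_mul k 1 0; rewrite mul1r addr0 => ->.
  by rewrite div0z mod0z greedy_cost0.
rewrite greedy_costS_small ?IHk // ltW ?denomination_gt0 //=.
by case: k ik {IHk} => // k ik; apply: lt_s.
Qed.

Lemma greedy_cost_mul_le k x (c : nat) : subadditive_cost k ->
  0 <= x -> greedy_cost s k x <= 1 -> greedy_cost s k (c%:Z * x) <= c%:Z.
Proof.
move=> subk x0 cx; elim: c => [|c IHc].
  by rewrite mul0r greedy_cost0.
have -> : c.+1%:Z * x = c%:Z * x + x by lia.
have cx0 : 0 <= c%:Z * x by rewrite mulr_ge0.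
apply: le_trans (subk _ _ cx0 x0) _.
by rewrite -addn1 PoszD lerD.
Qed.

Lemma greedy_cost_le_payment k (w : nat -> int) : subadditive_cost k ->
    (forall i, (i < k)%N -> 0 <= w i) ->
  greedy_cost s k (\sum_(i < k) w i * s i.+1) <= \sum_(i < k) w i.
Proof.
move=> subk w0.
(* The cost stays that of the full prefix [k] while the sum grows; nonnegativity of the partial sum
   is carried along because subadditivity asks for it. *)
suff H n : (n <= k)%N ->
    0 <= \sum_(i < n) w i * s i.+1 /\
    greedy_cost s k (\sum_(i < n) w i * s i.+1) <= \sum_(i < n) w i.
  by have [] := H k.
elim: n => [_|n IHn nk].
  by rewrite !big_ord0 greedy_cost0.
have [sum0 costn] := IHn (ltnW nk).
have sp := denomination_gt0 n; have wn := w0 _ nk.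
have ws0 : 0 <= w n * s n.+1 by rewrite mulr_ge0 // ltW.
rewrite !big_ord_recr /=; split; first exact: addr_ge0.
apply: le_trans (subk _ _ sum0 ws0) _; apply: lerD => //.
case: (w n) wn => // c _.
by rewrite greedy_cost_mul_le // ?denomination_cost // ltW.
Qed.

(** Subadditivity climbs from prefix to prefix, starting from the single coin 1, whose cost function
    is the identity. *)
Lemma totally_greedy_of_exchange :
  (forall k, (1 <= k)%N -> subadditive_cost k -> exchange_cost k) ->
  totally_greedy s.
Proof.
move=> ex; split=> // k k1 x x0.
have subk : subadditive_cost k.
  elim: k k1 => [//|[|k] IHk] _; first by move=> y z _ _; rewrite !greedy_cost1.
  by apply: subadditive_costS; [apply: ex => //|]; apply: IHk.
have value w : \sum_(i < size (prefix_set s k)) w`_i * (prefix_set s k)`_i =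
    \sum_(i < k) w`_i * s i.+1.
  rewrite size_prefix_set; apply: eq_bigr => i _.
  by rewrite nth_prefix_set.
split.
  split; first by rewrite size_greedy_payment size_prefix_set.
    by move=> i; rewrite size_prefix_set; apply: greedy_payment_ge0.
  by rewrite value greedy_payment_value.
move=> w [_]; rewrite value size_prefix_set sum_greedy_payment => w0 <-.
exact: (greedy_cost_le_payment (w := nth 0 w)).
Qed.

End Greedy.

Lemma type2_sequence_pos_incr (J : nat -> int) : type2_sequence J ->
  forall i, 0 < J i.+1 /\ J i.+1 < J i.+2.
Proof.
move=> [a [p [q [[a1 p0 q1 qp] [J1 J2 rec]]]]].
elim=> [|i [Ji lt_J]]; first by rewrite J1 J2; split; lia.
have := rec i.+3 isT; rewrite subn1 subn2 /= => ->.
(* The new difference is [(p - 1) * J i.+2 - q * J i.+1], positive since [q < p - 1] and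
   [0 < J i.+1 < J i.+2]. *)
by split; nia.
Qed.

Lemma type2_totally_greedy (J : nat -> int) :
  type2_sequence J -> totally_greedy J.
Proof.
move=> type2; have posJ := type2_sequence_pos_incr type2.
case: type2 => [a [p [q [[a1 p0 q1 qp] [J1 J2 rec]]]]].
have incrJ i : (1 <= i)%N -> J i < J i.+1 by case: i => // i _; case: (posJ i).
apply: totally_greedy_of_exchange => // -[//|[|k]] _ subk y y0.
  by rewrite !greedy_cost1 // J2; lia.
have [Jk _] := posJ k; have [Jk2 _] := posJ k.+2.
have q0 : 0 <= q by lia.
have qJ0 : 0 <= q * J k.+1 by rewrite mulr_ge0 // ltW.
have yJ0 : 0 <= y + J k.+3 by lia.
have shift : greedy_cost J k.+2 (y + J k.+3 + q * J k.+1) =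
             p + greedy_cost J k.+2 y.
  have := rec k.+3 isT; rewrite subn1 subn2 /= => ->.
  have -> : y + (p * J k.+2 - q * J k.+1) + q * J k.+1 = p * J k.+2 + y by ring.
  exact: (greedy_costD_mul J1 incrJ k.+1).
have costq : greedy_cost J k.+2 (q * J k.+1) <= q.
  case: (q) q0 => // c _.
  by rewrite (greedy_cost_mul_le (s := J)) ?denomination_cost // ltW.
(* The net gain is at least [p - q], which exceeds 1. *)
have := subk _ _ yJ0 qJ0; rewrite shift; lia.
Qed.

Lemma odd_subsequence_type1 (G : nat -> int) :
  type1_sequence G -> type2_sequence (odd_subsequence G).
Proof.
move=> [a [p [q [[a1 p0 q0 qp] [G1 G2 rec]]]]].
(* The first witness is [G 3]. The last bound follows from [q ^+ 2 <= p ^+ 2] and [1 < 2 * q]. *)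
exists (p * a + q), (p ^+ 2 + 2 * q), (q ^+ 2); split; first by split; nia.
split; [by [] | by rewrite /odd_subsequence /= rec // G1 G2 mulr1 |].
move=> [|[|[|n]]] // _; rewrite /odd_subsequence.
have -> : (2 * n.+3 - 1 = (2 * n).+1.+4)%N by lia.
have -> : (2 * (n.+3 - 1) - 1 = (2 * n).+3)%N by lia.
have -> : (2 * (n.+3 - 2) - 1 = (2 * n).+1)%N by lia.
(* Everything reduces to the terms at [2n+1] and [2n+2], leaving a polynomial identity. *)
have r5 := rec (2 * n).+1.+4 isT; have r4 := rec (2 * n).+4 isT.
have r3 := rec (2 * n).+3 isT.
rewrite !(subn1, subn2) /= in r5 r4 r3.
by rewrite r5 r4 r3; ring.
Qed.

Lemma odd_subsequence_type2 (J : nat -> int) :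
  type2_sequence J -> type2_sequence (odd_subsequence J).
Proof.
move=> [a [p [q [[a1 p0 q1 qp] [J1 J2 rec]]]]].
(* The last bound amounts to [(q + 1) ^+ 2 < p ^+ 2], that is, to [q < p - 1]. *)
exists (p * a - q), (p ^+ 2 - 2 * q), (q ^+ 2); split; first by split; nia.
split; [by [] | by rewrite /odd_subsequence /= rec // J1 J2 mulr1 |].
move=> [|[|[|n]]] // _; rewrite /odd_subsequence.
have -> : (2 * n.+3 - 1 = (2 * n).+1.+4)%N by lia.
have -> : (2 * (n.+3 - 1) - 1 = (2 * n).+3)%N by lia.
have -> : (2 * (n.+3 - 2) - 1 = (2 * n).+1)%N by lia.
have r5 := rec (2 * n).+1.+4 isT; have r4 := rec (2 * n).+4 isT.
have r3 := rec (2 * n).+3 isT.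
rewrite !(subn1, subn2) /= in r5 r4 r3.
by rewrite r5 r4 r3; ring.
Qed.

Theorem corollary4 (G J : nat -> int)
    (hG : type1_sequence G) (hGgreedy : totally_greedy G)
    (hJ : type2_sequence J) (hJgreedy : totally_greedy J) :
  totally_greedy (odd_subsequence G) /\ totally_greedy (odd_subsequence J).
Proof.
by split; apply: type2_totally_greedy;
  [apply: odd_subsequence_type1 | apply: odd_subsequence_type2].
Qed.
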